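(* Let $\mathcal{T} = (T, \eta, \mu)$ be a monad over a category $\mathbb{C}$. If $\mathbb{C}$ has a terminal object $\mathbf{1}$, then $\bar{\mathbf{1}} = (\mathbf{1}, !_{T\mathbf{1}})$ is a terminal object in the Eilenberg–Moore category $\mathbb{C}^{\mathcal{T}}$, where $!_{T\mathbf{1}} : T\mathbf{1} \to \mathbf{1}$ is the unique morphism from $T\mathbf{1}$ to $\mathbf{1}$ in $\mathbb{C}$.
   Context: A monad $\mathcal{T} = (T, \eta, \mu)$ over $\mathbb{C}$ consists of an endofunctor $T : \mathbb{C} \to \mathbb{C}$ and natural transformations $\eta : \mathrm{id}_{\mathbb{C}} \to T$ and $\mu : T^2 \to T$ with $\mu_A \circ T\mu_A = \mu_A \circ \mu_{TA}$ and $\mu_A \circ \eta_{TA} = \mathrm{id}_{TA} = \mu_A \circ T\eta_A$ for every object $A$. The Eilenberg–Moore category $\mathbb{C}^{\mathcal{T}}$ has as objects the $\mathcal{T}$-algebras, i.e. pairs $\bar{A} = (A, f_A)$ with $A$ an object of $\mathbb{C}$ and $f_A : TA \to A$ a morphism of $\mathbb{C}$ such that $f_A \circ \eta_A = \mathrm{id}_A$ and $f_A \circ \mu_A = f_A \circ T f_A$. A morphism $(A, f_A) \to (B, f_B)$ is a morphism $f : A \to B$ in $\mathbb{C}$ such that $f \circ f_A = f_B \circ Tf$. Identities and composition are those of $\mathbb{C}$. *)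

(* Defs.v *)
From Stdlib Require Import ClassicalEpsilon.

Set Implicit Arguments.
Unset Strict Implicit.
Unset Printing Implicit Defensive.

Declare Scope cat_scope.
Delimit Scope cat_scope with cat.
Open Scope cat_scope.

Record category : Type := Category {
  obj :> Type;
  hom : obj -> obj -> Type;
  idm : forall A : obj, hom A A;
  comp : forall A B D : obj, hom B D -> hom A B -> hom A D;
  comp_idl : forall (A B : obj) (f : hom A B), comp (idm B) f = f;
  comp_idr : forall (A B : obj) (f : hom A B), comp f (idm A) = f;
  comp_assoc : forall (A B D E : obj)
      (h : hom D E) (g : hom B D) (f : hom A B),
    comp h (comp g f) = comp (comp h g) f
}.

Arguments hom {_} _ _.
Arguments idm {_} _.
Arguments comp {_ _ _ _} _ _.

Notation "g \o f" := (comp g f) (at level 40, left associativity) : cat_scope.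

Record functor (C D : category) : Type := Functor {
  fobj :> C -> D;
  fmap : forall A B : C, hom A B -> hom (fobj A) (fobj B);
  fmap_id : forall A : C, fmap (idm A) = idm (fobj A);
  fmap_comp : forall (A B E : C) (g : hom B E) (f : hom A B),
    fmap (g \o f) = fmap g \o fmap f
}.

Arguments fmap {_ _} _ {_ _} _.

Definition functor_id (C : category) : functor C C :=
  @Functor C C (fun A => A) (fun _ _ f => f)
    (fun A => eq_refl) (fun _ _ _ _ _ => eq_refl).

Section FunctorComp.
Variables (C D E : category) (G : functor D E) (F : functor C D).

Lemma functor_comp_id (A : C) : fmap G (fmap F (idm A)) = idm (G (F A)).
Proof. now rewrite !fmap_id. Qed.

Lemma functor_comp_comp (A B X : C) (g : hom B X) (f : hom A B) :
  fmap G (fmap F (g \o f)) = fmap G (fmap F g) \o fmap G (fmap F f).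
Proof. now rewrite !fmap_comp. Qed.

Definition functor_comp : functor C E :=
  @Functor C E (fun A => G (F A)) (fun _ _ f => fmap G (fmap F f))
    functor_comp_id functor_comp_comp.
End FunctorComp.

Record nat_trans (C D : category) (F G : functor C D) : Type := NatTrans {
  component :> forall A : C, hom (F A) (G A);
  naturality : forall (A B : C) (f : hom A B),
    component B \o fmap F f = fmap G f \o component A
}.

Record monad (C : category) : Type := Monad {
  mfunctor :> functor C C;
  eta : nat_trans (functor_id C) mfunctor;
  mu : nat_trans (functor_comp mfunctor mfunctor) mfunctor;
  mu_assoc : forall A : C,
    mu A \o fmap mfunctor (mu A) = mu A \o mu (mfunctor A);
  mu_eta_l : forall A : C, mu A \o eta (mfunctor A) = idm (mfunctor A);
  mu_eta_r : forall A : C, mu A \o fmap mfunctor (eta A) = idm (mfunctor A)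
}.

Arguments eta {_} _.
Arguments mu {_} _.

Section EilenbergMoore.
Variables (C : category) (T : monad C).

Record is_algebra (A : C) (f : hom (T A) A) : Prop := IsAlgebra {
  alg_unit : f \o eta T A = idm A;
  alg_mult : f \o mu T A = f \o fmap T f
}.

Record algebra : Type := Algebra {
  carrier : C;
  action : hom (T carrier) carrier;
  algebraP : is_algebra action
}.

Definition is_alg_hom (A B : algebra) (f : hom (carrier A) (carrier B)) : Prop :=
  f \o action A = action B \o fmap T f.

Record alg_hom (A B : algebra) : Type := AlgHom {
  alg_map : hom (carrier A) (carrier B);
  alg_homP : is_alg_hom alg_map
}.

Lemma alg_hom_eq (A B : algebra) (f g : alg_hom A B) :
  alg_map f = alg_map g -> f = g.
Proof.
destruct f as [f Hf], g as [g Hg]; simpl; intros e; destruct e.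
now rewrite (proof_irrelevance _ Hf Hg).
Qed.

Lemma is_alg_hom_id (A : algebra) : is_alg_hom (A:=A) (B:=A) (idm (carrier A)).
Proof. unfold is_alg_hom. now rewrite fmap_id, comp_idl, comp_idr. Qed.

Lemma is_alg_hom_comp (A B D : algebra) (g : alg_hom B D) (f : alg_hom A B) :
  is_alg_hom (A:=A) (B:=D) (alg_map g \o alg_map f).
Proof.
unfold is_alg_hom.
rewrite fmap_comp, <- comp_assoc, (alg_homP f), comp_assoc, (alg_homP g).
now rewrite comp_assoc.
Qed.

Definition alg_id (A : algebra) : alg_hom A A := AlgHom (is_alg_hom_id A).

Definition alg_comp (A B D : algebra) (g : alg_hom B D) (f : alg_hom A B) :
  alg_hom A D := AlgHom (is_alg_hom_comp g f).

Lemma alg_comp_idl (A B : algebra) (f : alg_hom A B) : alg_comp (alg_id B) f = f.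
Proof. apply alg_hom_eq, comp_idl. Qed.

Lemma alg_comp_idr (A B : algebra) (f : alg_hom A B) : alg_comp f (alg_id A) = f.
Proof. apply alg_hom_eq, comp_idr. Qed.

Lemma alg_comp_assoc (A B D E : algebra)
    (h : alg_hom D E) (g : alg_hom B D) (f : alg_hom A B) :
  alg_comp h (alg_comp g f) = alg_comp (alg_comp h g) f.
Proof. apply alg_hom_eq, comp_assoc. Qed.

Definition eilenberg_moore : category :=
  @Category algebra alg_hom alg_id alg_comp
    alg_comp_idl alg_comp_idr alg_comp_assoc.
End EilenbergMoore.

Arguments is_algebra {C} T {A} f.

Definition is_terminal (C : category) (X : C) : Prop :=
  forall A : C, exists f : hom A X, forall g : hom A X, g = f.

Arguments is_terminal : clear implicits.

(* The unique morphism [!_A : A -> X] into a terminal object; since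
   [is_terminal] is a proposition, it is extracted by description. *)
Definition bang (C : category) (X : C) (hX : is_terminal C X) (A : C) : hom A X :=
  proj1_sig (constructive_indefinite_description _ (hX A)).

Lemma bang_unique (C : category) (X : C) (hX : is_terminal C X) (A : C)
    (f : hom A X) : f = bang hX A.
Proof.
exact (proj2_sig (constructive_indefinite_description _ (hX A)) f).
Qed.

(* Main.v *)
Require Import Defs.

(** Every equation to be checked (the two algebra laws and the homomorphism
    square) is between parallel morphisms of the base category with codomain
    the terminal object, and such morphisms are equal by [terminal_hom_eq].
    Since a homomorphism of algebras is determined by its underlying morphism
    ([alg_hom_eq]), uniqueness is inherited from the base category as well. *)

Lemma terminal_hom_eq {C : category} {X : C} (hX : is_terminal C X) {A : C}
    (f g : hom A X) : f = g.
Proof. now rewrite (bang_unique hX f), (bang_unique hX g). Qed.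

Theorem theorem1 (C : category) (T : monad C)
    (one : C) (one_terminal : is_terminal C one) :
  exists one_alg : is_algebra T (bang one_terminal (T one)),
    is_terminal (eilenberg_moore T) (Algebra one_alg).
Proof.
assert (one_alg : is_algebra T (bang one_terminal (T one))).
{ split; apply (terminal_hom_eq one_terminal). }
exists one_alg; intros A.
assert (bangP : is_alg_hom (A:=A) (B:=Algebra one_alg)
                  (bang one_terminal (carrier A))).
{ apply (terminal_hom_eq one_terminal). }
exists (AlgHom bangP); intros g.
apply alg_hom_eq, (terminal_hom_eq one_terminal).
Qed.
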